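(* Let $G$ be a group, let $S$ be a subgroup of $G$ such that the index $|G:S|$ is infinite, and let $X=G/S$ be the space of left cosets of $S$ in $G$, with $G$ acting by left multiplication. Then every free ultrafilter on $X$ is $G$-selective if and only if, for each subgroup $T$ of $G$ such that $S\subset T\subset G$, either $|T:S|$ is finite or $|G:T|$ is finite.
   Context: $|T:S|$ denotes the index of $S$ in $T$. A partition $\mathcal{P}$ of a $G$-space $X$ is $G$-invariant if $gP\in\mathcal{P}$ for all $g\in G$ and $P\in\mathcal{P}$. An ultrafilter is free if it is non-principal. A free ultrafilter $\mathcal{U}$ on an infinite transitive $G$-space $X$ is $G$-selective if, for every $G$-invariant partition $\mathcal{P}$ of $X$, either some cell of $\mathcal{P}$ is a member of $\mathcal{U}$, or there exists $U\in\mathcal{U}$ such that $|P\cap U|\leqslant 1$ for each $P\in\mathcal{P}$. *)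

(* Defs.v *)
From mathcomp Require Import all_boot.
From mathcomp Require Import boolp classical_sets functions cardinality filter.

Set Implicit Arguments.
Unset Strict Implicit.
Unset Printing Implicit Defensive.

Local Open Scope classical_set_scope.
Local Open Scope group_scope.

Record gaction (G : groupType) (X : Type) := GAction {
  gact :> G -> X -> X;
  gact1 : forall x, gact 1 x = x;
  gactM : forall g h x, gact (g * h) x = gact g (gact h x)
}.

Definition gtransitive (G : groupType) (X : Type) (a : gaction G X) :=
  forall x y, exists g, a g x = y.

Definition invariant_partition (G : groupType) (X : Type) (a : gaction G X)
    (P : set (set X)) :=
  partition P id [set: X] /\ forall g A, P A -> P (a g @` A).

Definition free_ultrafilter (X : Type) (U : set_system X) :=
  UltraFilter U /\ ~ exists x, U = principal_filter x.

(* Only meant for a free ultrafilter on an infinite transitive G-space;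
   those standing assumptions are not repeated here. *)
Definition selective (G : groupType) (X : Type) (a : gaction G X)
    (U : set_system X) :=
  forall P, invariant_partition a P ->
    (exists2 A, P A & U A) \/
    (exists2 V, U V & forall A, P A -> is_subset1 (A `&` V)).

(* A subgroup is a [groupClosed] boolean predicate; classically every set of
   elements is the extension of such a predicate. *)
Section Cosets.
Variables (G : groupType) (S : groupClosed G).

Definition ltrans (g : G) (A : set G) : set G := [set g * x | x in A].

(* The cosets t S for t in T; these are the left cosets of S in T as soon as
   S is contained in T. *)
Definition lcosets_in (T : set G) : set (set G) :=
  [set ltrans t [set` S] | t in T].

Definition coset_space : Type := set_type (lcosets_in [set: G]).

Lemma ltrans1 A : ltrans 1 A = A.
Proof.
by apply/seteqP; split=> [_ [x Ax <-]|x Ax]; [|exists x]; rewrite ?mul1g.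
Qed.

Lemma ltransM g h A : ltrans (g * h) A = ltrans g (ltrans h A).
Proof.
apply/seteqP; split=> [_ [x Ax <-]|_ [_ [x Ax <-] <-]].
  by exists (h * x); [exists x|rewrite mulgA].
by exists x; rewrite ?mulgA.
Qed.

Lemma ltrans_lcosets g A :
  A \in lcosets_in [set: G] -> ltrans g A \in lcosets_in [set: G].
Proof.
by move=> /set_mem[t _ <-]; apply/mem_set; exists (g * t); rewrite ?ltransM.
Qed.

Definition coset_act (g : G) (x : coset_space) : coset_space :=
  exist _ (ltrans g (sval x)) (ltrans_lcosets g (svalP x)).

Lemma coset_act1 x : coset_act 1 x = x.
Proof. by apply/val_inj; rewrite /= ltrans1. Qed.

Lemma coset_actM g h x : coset_act (g * h) x = coset_act g (coset_act h x).
Proof. by apply/val_inj; rewrite /= ltransM. Qed.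

Definition coset_action : gaction G coset_space :=
  GAction coset_act1 coset_actM.

Lemma coset_action_transitive : gtransitive coset_action.
Proof.
move=> [A Ain] [B Bin]; have [s _ sA] := set_mem Ain.
have [t _ tB] := set_mem Bin; exists (t / s).
by apply/val_inj; rewrite /= -sA -tB -ltransM mulgVK.
Qed.

End Cosets.

(* |T : S| is finite, for subgroups S of T. *)
Definition finite_index (G : groupType) (T : set G) (S : groupClosed G) :=
  finite_set (lcosets_in S T).

Lemma coset_space_infinite (G : groupType) (S : groupClosed G) :
  ~ finite_index [set: G] S -> infinite_set [set: coset_space S].
Proof.
move=> Sinf Xfin; apply: Sinf; rewrite /finite_index.
have -> : lcosets_in S [set: G] = [set sval x | x in [set: coset_space S]].
  apply/seteqP; split=> [A SA|_ [x _ <-]]; last exact: set_mem (svalP x).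
  by exists (exist _ A (mem_set SA)).
exact: finite_image.
Qed.

(* Main.v *)
(** For a subgroup T containing S the sets gT/S form an invariant partition of
    G/S into |G:T| cells of size |T:S|, and every invariant partition arises
    this way, T being the setwise stabiliser of the cell of S.  If there are
    finitely many cells, an ultrafilter contains one of them; if one cell A is
    finite, translating every cell onto A colours G/S with the finitely many
    points of A, injectively on each cell, and some colour class is in the
    ultrafilter.  If there are infinitely many cells, all infinite, the sets A
    such that all but finitely many cells are almost contained in A form a
    filter, and any ultrafilter above it is free and not selective. *)
Require Import Defs.
From HB Require Import structures.
From mathcomp Require Import all_boot.
From mathcomp Require Import finmap.
From mathcomp Require Import boolp classical_sets functions cardinality filter.

Local Open Scope classical_set_scope.
Local Open Scope group_scope.

(** * Partitions and ultrafilters on a set *)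

Lemma partition_cell_unique {X : Type} {P : set (set X)} {A B : set X} {x : X} :
  partition P id [set: X] -> P A -> P B -> A x -> B x -> A = B.
Proof. by move=> [_ tP _] PA PB Ax Bx; apply: (tP A B PA PB); exists x. Qed.

Lemma partition_cell_ex {X : Type} {P : set (set X)} (x : X) :
  partition P id [set: X] -> exists2 A, P A & A x.
Proof.
by move=> [cP _ _]; have : cover P id x by [rewrite cP]; move=> [A]; exists A.
Qed.

(** If no fibre of [c] were in [U], the finite intersection of their complements would be in [U],
    yet it is empty. *)
Lemma ultra_finite_range {X K : Type} {U : set_system X} (c : X -> K) :
  UltraFilter U -> finite_set (range c) -> exists k, U (c @^-1` [set k]).
Proof.
move=> UU cfin; apply: contrapT => /forallNP noU.
have cfin' : finite_set (range (c : X -> {classic K})) by [].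
pose D := fset_set (range (c : X -> {classic K})).
have UI : U (\bigcap_(k in [set` D]) ~` (c @^-1` [set k])).
  apply: filter_bigI => k _.
  by have [/noU//|] := in_ultra_setVsetC (c @^-1` [set k : K]) UU.
have [x xI] := filter_ex UI.
by apply: (xI (c x)) => //=; rewrite in_fset_set// inE; exists x.
Qed.

Lemma exists_nonselective_ultrafilter {X : Type} {P : set (set X)} :
  partition P id [set: X] -> infinite_set P ->
  (forall A, P A -> infinite_set A) ->
  exists U : set_system X, [/\ free_ultrafilter U,
    forall A, P A -> ~ U A &
    forall V, U V -> ~ forall A, P A -> is_subset1 (A `&` V)].
Proof.
move=> partP Pinf cellinf.
pose F : set_system X :=
  [set A | finite_set [set B | P B /\ infinite_set (B `\` A)]].
have FF : ProperFilter F.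
  split.
    (* Every cell is infinite, so each one is an exception for the empty set. *)
    move=> F0; apply: Pinf; apply: sub_finite_set F0 => B PB; split=> //.
    by rewrite setD0; apply: cellinf.
  split=> [|A B FA FB|A B AB].
  - apply: (sub_finite_set _ (finite_set0 _)) => B [_]; apply.
    by rewrite setDT; exact: finite_set0.
  - have /sub_finite_set : [set C | P C /\ infinite_set (C `\` (A `&` B))] `<=`
        [set C | P C /\ infinite_set (C `\` A)] `|`
        [set C | P C /\ infinite_set (C `\` B)].
      move=> C [PC]; rewrite setDIr => Cinf; apply: contrapT.
      move=> /not_orP[/not_andP[//|/contrapT CA] /not_andP[//|/contrapT CB]].
      by apply: Cinf; rewrite finite_setU.
    by apply; rewrite finite_setU.
  - apply: sub_finite_set => C [PC Cinf]; split=> // Cfin; apply: Cinf.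
    by apply: sub_finite_set Cfin => x [Cx nB]; split=> // /AB.
have [U [UU FU]] := ultraFilterLemma FF.
have notU V : F (~` V) -> ~ U V.
  by move=> /FU UnV UV; have [x []] := filter_ex (filterI UV UnV).
(* For such a [V], each [B] minus the complement of [V] is [B] meet [V], a finite set, so no cell is
   an exception. *)
have selU V : (forall A, P A -> is_subset1 (A `&` V)) -> ~ U V.
  move=> Vsel; apply: notU.
  apply: (sub_finite_set _ (finite_set0 _)) => B [PB]; apply.
  rewrite setDE setCK; have [->|/set0P[x BVx]] := eqVneq (B `&` V) set0.
    exact: finite_set0.
  by apply: sub_finite_set (finite_set1 x) => y /Vsel; apply.
exists U; split=> //.
- split=> // -[x Ux].
  (* A singleton meets each cell at most once, so [U] cannot be principal. *)
  apply: (selU [set x]); last by rewrite Ux; apply/principal_filterP.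
  by move=> A _ y z [_ /= ->] [_ /= ->].
(* The only possible exception for the complement of [A] is [A] itself, as the other cells are
   disjoint from it. *)
- move=> A PA; apply: notU; apply: (sub_finite_set _ (finite_set1 A)).
  move=> B [PB Binf]; apply: contrapT => /= BA; apply: Binf.
  rewrite (_ : _ `\` _ = set0); first exact: finite_set0.
  apply/seteqP; split=> // x [Bx /contrapT Ax].
  exact/BA/(partition_cell_unique partP PB PA Bx Ax).
- by move=> V UV /selU; apply.
Qed.

Lemma ltransP {G : groupType} (A : set G) (g h : G) :
  ltrans g A h <-> A (g^-1 * h).
Proof.
split=> [[x Ax <-]|Agh]; first by rewrite mulKg.
by exists (g^-1 * h); rewrite // mulVKg.
Qed.

Lemma ltrans_subgroup {G : groupType} {T : groupClosed G} {g h : G} :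
  g^-1 * h \in T -> ltrans g [set` T] = ltrans h [set` T].
Proof.
move=> gh; have -> : h = g * (g^-1 * h) by rewrite mulVKg.
rewrite ltransM; congr ltrans; apply/seteqP; split=> x /= Tx.
  by apply/ltransP; rewrite /= gpredM// gpredV.
by have /ltransP/= := Tx; rewrite gpredMl// gpredV.
Qed.

(** * Invariant partitions and subgroups *)

Section Actions.
Context {G : groupType} {X : Type} {a : gaction G X}.
Implicit Types (P : set (set X)) (A B : set X) (x : X) (T : groupClosed G).

Lemma gactK g : cancel (a g) (a g^-1).
Proof. by move=> x; rewrite -gactM mulVg gact1. Qed.

Lemma gactKV g : cancel (a g^-1) (a g).
Proof. by move=> x; rewrite -gactM mulgV gact1. Qed.

Lemma invariant_cellE {P A B} {x : X} {g : G} : invariant_partition a P ->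
  P A -> A x -> P B -> B (a g x) -> B = a g @` A.
Proof.
move=> [partP invP] PA Ax PB Bgx.
by apply: (partition_cell_unique partP PB _ Bgx); [exact: invP|exists x].
Qed.

(** An element moving [x] to a point of [A] maps the whole cell onto itself, so testing the single
    point [x] describes the setwise stabiliser of [A]. *)
Lemma cell_stabiliser {P A x} : invariant_partition a P -> P A -> A x ->
  exists T, [set` T] = [set g | A (a g x)].
Proof.
move=> invP PA Ax; pose T : {pred G} := [pred g | `[< A (a g x) >]].
have stabA g : A (a g x) -> A = a g @` A.
  exact: (invariant_cellE invP PA Ax PA).
have T1 : 1 \in T by apply/asboolP; rewrite gact1.
have TM : mulg_closed T.
  move=> g h /asboolP gA /asboolP hA; apply/asboolP.
  by rewrite gactM (stabA _ gA); exists (a h x).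
have TV : invg_closed T.
  move=> g /asboolP gA; apply/asboolP.
  have := Ax; rewrite {1}(stabA _ gA) => -[y Ay <-].
  by rewrite gactK.
pose TT : groupClosed G := HB.pack T (isMul1Closed.Build G T T1)
  (isMulClosed.Build G T TM) (isInvClosed.Build G T TV).
exists TT; apply/seteqP; split=> g /=; first by move/asboolP.
by move=> Agx; apply/asboolP.
Qed.

(** By transitivity [A] is the [T]-orbit of [x] and each cell is a translate of [A], hence the image
    of a left coset of [T]. *)
Lemma invariant_partitionE {P A x T} : gtransitive a ->
    invariant_partition a P -> P A -> [set` T] = [set g | A (a g x)] ->
  P = [set [set a g x | g in C] | C in lcosets_in T [set: G]].
Proof.
move=> atrans invP PA TE.
have Ax : A x.
  by have : [set` T] 1 by [exact: gpred1]; rewrite TE /= gact1.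
have AE : A = [set a g x | g in [set` T]].
  rewrite TE; apply/seteqP; split=> [y Ay|_ [g Agx <-]//].
  by have [g gx] := atrans x y; exists g; rewrite /= gx.
have imE g : a g @` A = [set a h x | h in ltrans g [set` T]].
  rewrite AE; apply/seteqP; split=> [_ [_ [h Th <-] <-]|_ [_ [h Th <-] <-]].
    by exists (g * h); rewrite ?gactM//; exists h.
  by rewrite gactM; exists (a h x) => //; exists h.
apply/seteqP; split=> [B PB|_ [_ [g _ <-] <-]]; last first.
  by rewrite -imE; apply: invP.2.
have [_ _ /(_ B PB) [y By]] := invP.1.
have [g gx] := atrans x y; exists (ltrans g [set` T]); first by exists g.
by rewrite -imE; apply/esym/(invariant_cellE invP PA Ax PB); rewrite gx.
Qed.

Section Blocks.
Context {x : X} {T : groupClosed G}.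
Hypothesis stabT : forall g, a g x = x -> g \in T.

(** Since [T] contains the stabiliser of [x], the preimage of a block under [h |-> a h x] is exactly
    one coset of [T]; blocks thus correspond to cosets. *)
Lemma block_mem g h :
  [set a k x | k in ltrans g [set` T]] (a h x) <-> ltrans g [set` T] h.
Proof.
split=> [[k /ltransP gk kh]|]; last by exists h.
apply/ltransP; rewrite /= -(mulVKg k h) mulgA gpredM// stabT//.
by rewrite gactM -kh gactK.
Qed.

Lemma blocks_invariant_partition : gtransitive a ->
  invariant_partition a
    [set [set a g x | g in C] | C in lcosets_in T [set: G]].
Proof.
move=> atrans; split; first split.
- apply/seteqP; split=> // y _; have [g <-] := atrans x y.
  exists [set a k x | k in ltrans g [set` T]].
    by exists (ltrans g [set` T]) => //; exists g.
  by apply/block_mem/ltransP; rewrite mulVg /= gpred1.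
- move=> _ _ [_ [g _ <-] <-] [_ [h _ <-] <-] [y [+ +]].
  have [k <-] := atrans x y => /block_mem/ltransP gk /block_mem/ltransP hk.
  by rewrite (ltrans_subgroup gk) (ltrans_subgroup hk).
- move=> _ [_ [g _ <-] <-]; exists (a g x).
  by apply/block_mem/ltransP; rewrite mulVg /= gpred1.
- move=> h _ [_ [g _ <-] <-]; exists (ltrans (h * g) [set` T]).
    by exists (h * g).
  apply/seteqP; split=> [_ [k + <-]|_ [_ [k + <-] <-]].
    rewrite ltransM => -[l gl <-]; rewrite gactM.
    by exists (a l x) => //; exists l.
  move=> gk; exists (h * k); last by rewrite gactM.
  by rewrite ltransM; exists k.
Qed.

Lemma infinite_blocks : ~ finite_index [set: G] T ->
  infinite_set [set [set a g x | g in C] | C in lcosets_in T [set: G]].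
Proof.
move=> Tinf fin; apply: Tinf.
apply: sub_finite_set (finite_image (fun A => [set g | A (a g x)]) fin).
move=> _ [g _ <-]; exists [set a k x | k in ltrans g [set` T]].
  by exists (ltrans g [set` T]) => //; exists g.
by apply/seteqP; split=> h /= /block_mem.
Qed.

Lemma infinite_block g : infinite_set [set a k x | k in [set` T]] ->
  infinite_set [set a k x | k in ltrans g [set` T]].
Proof.
move=> Tinf fin; apply: Tinf.
apply: sub_finite_set (finite_image (a g^-1) fin) => _ [k Tk <-].
exists (a (g * k) x); first by exists (g * k) => //; exists k.
by rewrite gactM gactK.
Qed.

End Blocks.

Lemma finite_cell_selector {P A} {U : set_system X} : UltraFilter U ->
    gtransitive a -> invariant_partition a P -> P A -> finite_set A ->
  exists2 V, U V & forall B, P B -> is_subset1 (B `&` V).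
Proof.
move=> UU atrans invP PA Afin; have [_ _ /(_ A PA) [x Ax]] := invP.1.
have /choice[cell cellP] (y : X) : exists B, P B /\ B y.
  by have [B] := partition_cell_ex y invP.1; exists B.
(* [t B] carries [A] onto the cell [B]; the value 1 off [P] is a dummy. *)
have /choice[t tP] (B : set X) : exists g, P B -> B = a g @` A.
  have [PB|nPB] := pselect (P B); last by exists 1.
  have [_ _ /(_ B PB) [y By]] := invP.1; have [g gx] := atrans x y.
  by exists g => _; apply: (invariant_cellE invP PA Ax PB); rewrite gx.
pose c y := a (t (cell y))^-1 y.
have cA : range c `<=` A.
  move=> _ [y _ <-]; have [Pc cy] := cellP y.
  have [z Az zy] : (a (t (cell y)) @` A) y by rewrite -tP.
  by rewrite /c (canLR (gactK _) (esym zy)).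
have [k Uk] := ultra_finite_range c UU (sub_finite_set cA Afin).
exists (c @^-1` [set k]) => // B PB y z [By cy] [Bz cz].
have cellB w : B w -> cell w = B.
  by have [Pw cw] := cellP w; exact: (partition_cell_unique invP.1 Pw PB cw).
(* On the single cell [B] the colouring [c] is the action of one fixed element, hence injective. *)
have := etrans cy (esym cz); rewrite /c !cellB//.
exact: (can_inj (gactKV _)).
Qed.

End Actions.

(** * The coset space with its base point *)

Section CosetSpace.
Context {G : groupType} {S : groupClosed G}.

Lemma base_coset_subproof : [set` S] \in lcosets_in S [set: G].
Proof. by apply/mem_set; exists 1; rewrite ?ltrans1. Qed.

Definition base_coset : coset_space S := exist _ [set` S] base_coset_subproof.

Lemma base_coset_stabiliser g :
  coset_action S g base_coset = base_coset -> g \in S.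
Proof.
move=> /(congr1 sval)/= gS; have : [set` S] 1 by exact: gpred1.
by rewrite -gS => /ltransP/=; rewrite mulg1 gpredV.
Qed.

(** The injection [sval] maps this set of points onto the cosets counted by the index, so the index
    becomes the size of a cell. *)
Lemma finite_index_orbit (T : set G) : finite_index T S <->
  finite_set [set coset_action S g base_coset | g in T].
Proof.
rewrite /finite_index (_ : lcosets_in S T =
  sval @` [set coset_action S g base_coset | g in T]); last first.
  by rewrite image_comp.
split=> [fin|]; last exact: finite_image.
apply: sub_finite_set (@preimage_image _ _ sval _) _.
by apply: finite_preimage fin => x y _ _ /val_inj.
Qed.

End CosetSpace.

Theorem theorem2 (G : groupType) (S : groupClosed G)
    (infinite_index : ~ finite_index [set: G] S) :
  (forall U : set_system (coset_space S),
     free_ultrafilter U -> selective (coset_action S) U) <->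
  (forall T : groupClosed G, {subset S <= T} ->
     finite_index [set` T] S \/ finite_index [set: G] T).
Proof.
have atrans := @coset_action_transitive _ S.
split=> [sel T ST|idx U [UU _] P invP].
  apply: contrapT => /not_orP[TSinf GTinf].
  (* The stabiliser of the base coset lies in [S], hence in [T], so the blocks of [T] form an
     invariant partition. *)
  have stabT g : coset_action S g base_coset = base_coset -> g \in T.
    by move=> /base_coset_stabiliser/ST.
  have invP := blocks_invariant_partition stabT atrans.
  have [||U [Ufree noA noV]] := exists_nonselective_ultrafilter invP.1.
  - exact: infinite_blocks.
  - move=> _ [_ [g _ <-] <-]; apply: infinite_block.
    by move=> /finite_index_orbit.
  by have [[A /noA]|[V /noV]] := sel U Ufree _ invP.
have [A PA Ax] := partition_cell_ex base_coset invP.1.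
have [T TE] := cell_stabiliser invP PA Ax.
have PE := invariant_partitionE atrans invP PA TE.
have ST : {subset S <= T}.
  move=> s Ss; suff : [set` T] s by [].
  rewrite TE /= (_ : coset_act s base_coset = base_coset)//.
  apply/val_inj => /=; rewrite -[RHS]ltrans1; apply/esym/ltrans_subgroup.
  by rewrite invg1 mul1g.
(* If the index of [S] in [T] is finite, so is the cell [A]; otherwise there are finitely many
   cells. *)
have [/finite_index_orbit Afin|GTfin] := idx T ST.
  right; apply: (finite_cell_selector UU atrans invP PA).
  apply: sub_finite_set Afin => y; have [g <-] := atrans base_coset y.
  by exists g => //; rewrite TE.
left; have Pfin : finite_set P by rewrite PE; apply: finite_image.
have /choice[cell cellP] (y : coset_space S) : exists B, P B /\ B y.
  by have [B] := partition_cell_ex y invP.1; exists B.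
(* Colouring each point by its own cell uses finitely many colours, and a colour class lies in its
   cell. *)
have [|B UB] := ultra_finite_range cell UU.
  by apply: sub_finite_set Pfin => _ [y _ <-]; have [] := cellP y.
have [y yB] := filter_ex UB.
exists B; first by rewrite -yB; have [] := cellP y.
by apply: filterS UB => z <-; have [] := cellP z.
Qed.
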